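(* Let $a,b\in\mathbb{C}$ with $|ab|<1$ and let $x\in\mathbb{C}$. Then $$\frac{2\sqrt3}{1+\sqrt3}\sum_{m\in\mathbb{Z}}a^{\frac{3m(3m+1)}{2}}b^{\frac{3m(3m-1)}{2}}e^{2\pi imx}-\sqrt3\left[\sum_{m\in\mathbb{Z}}a^{\frac{(3m+1)(3m+2)}{2}}b^{\frac{3m(3m+1)}{2}}e^{2\pi i(m+1/3)x}+\sum_{m\in\mathbb{Z}}a^{\frac{3m(3m-1)}{2}}b^{\frac{(3m-1)(3m-2)}{2}}e^{2\pi i(m-1/3)x}\right]$$ $$=\left(ab,\,-ae^{\frac{2\pi i(x+1)}{3}},\,-be^{\frac{-2\pi i(x+1)}{3}}:ab\right)_\infty+\left(ab,\,-ae^{\frac{2\pi i(x-1)}{3}},\,-be^{\frac{-2\pi i(x-1)}{3}}:ab\right)_\infty-\frac{2}{1+\sqrt3}\left(ab,\,-ae^{\frac{2\pi ix}{3}},\,-be^{\frac{-2\pi ix}{3}}:ab\right)_\infty .$$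
   Context: Infinite product notation: $(\alpha:\beta)_\infty=\prod_{k=0}^\infty(1-\alpha\beta^k)$ for $|\beta|<1$, and $(\alpha,\gamma,\dots,\zeta:\beta)_\infty=(\alpha:\beta)_\infty(\gamma:\beta)_\infty\cdots(\zeta:\beta)_\infty$. All exponents of $a$ and $b$ are non-negative integers; $0^0=1$. *)

(* Defs.v *)
From Stdlib Require Import Reals ZArith List.
From Coquelicot Require Import Coquelicot.
Import ListNotations.

Open Scope R_scope.
Open Scope C_scope.

(* Euler's formula: e^(s + it) = e^s (cos t + i sin t). *)
Definition Cexp (z : C) : C :=
  ((exp (Re z) * cos (Im z))%R, (exp (Re z) * sin (Im z))%R).

(* Limit of a complex sequence; meaningful only when the sequence converges,
   see [CLim_seq_unique]. *)
Definition CLim_seq (u : nat -> C) : C :=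
  iota (fun l : C_CompleteNormedModule => filterlim u eventually (locally l)).

Definition CSeries (u : nat -> C) : C := CLim_seq (sum_n u).

Definition ZSeries (f : Z -> C) : C :=
  CSeries (fun n : nat => f (Z.of_nat n))
  + CSeries (fun n : nat => f (- Z.of_nat (S n))%Z).

Definition ex_ZSeries_abs (f : Z -> C) : Prop :=
  ex_series (fun n : nat => Cmod (f (Z.of_nat n)))
  /\ ex_series (fun n : nat => Cmod (f (- Z.of_nat (S n))%Z)).

Fixpoint Cprod (u : nat -> C) (n : nat) : C :=
  match n with
  | O => 1
  | S k => Cprod u k * u k
  end.

Definition qprod (alpha beta : C) : nat -> C :=
  Cprod (fun k : nat => 1 - alpha * beta ^ k).

(* (alpha : beta)_oo.  The limit of the partial products is allowed to be 0. *)
Definition qPoch (alpha beta : C) : C := CLim_seq (qprod alpha beta).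

Definition ex_qPoch (alpha beta : C) : Prop :=
  exists l : C, filterlim (qprod alpha beta) eventually (locally l).

(* (alpha, gamma, ..., zeta : beta)_oo *)
Definition qPochs (alphas : list C) (beta : C) : C :=
  fold_right (fun alpha p => qPoch alpha beta * p) (RtoC 1) alphas.

Lemma CLim_seq_unique (u : nat -> C) (l : C) :
  filterlim u eventually (locally l) -> CLim_seq u = l.
Proof. intros H. exact (iota_filterlim_locally u l H). Qed.

Lemma CSeries_unique (u : nat -> C) (l : C) : is_series u l -> CSeries u = l.
Proof. exact (CLim_seq_unique (sum_n u) l). Qed.

Lemma ZSeries_abs_correct (f : Z -> C) : ex_ZSeries_abs f ->
  is_series (fun n : nat => f (Z.of_nat n))
    (CSeries (fun n : nat => f (Z.of_nat n)))
  /\ is_series (fun n : nat => f (- Z.of_nat (S n))%Z)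
    (CSeries (fun n : nat => f (- Z.of_nat (S n))%Z)).
Proof.
assert (K : forall u : nat -> C,
  ex_series (fun n => Cmod (u n)) -> is_series u (CSeries u)).
{ intros u H.
  destruct (@ex_series_le C_AbsRing C_CompleteNormedModule u
              (fun n => Cmod (u n)) (fun n => Rle_refl _) H) as [l Hl].
  now rewrite (CSeries_unique _ _ Hl). }
intros [Hp Hn]. split; now apply K.
Qed.

(* Main.v *)
(* Put t_n = a^(n(n+1)/2) b^(n(n-1)/2) z^n and q = ab.  The Jacobi triple product
   sum_n t_n = (q, -az, -b/z : q)_oo is the limit of its finite form
     prod_(k<M) (1 + a q^k z) prod_(k<N) (1 + b q^k / z)
       = sum_n (q)_(M+N) / ((q)_(M-n) (q)_(N+n)) t_n,
   which holds by induction on M and N: multiplication by a q^M z shifts the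
   index, because q^M a z t_(n-1) = q^(M+1-n) t_n, and q-Pascal recombines the
   coefficients.  Working with (a, b) instead of (q, z) needs no division by q,
   so ab = 0 is not a special case.  Applying the triple product at
   z = w e^(2 pi i s/3), s = 1, -1, 0, with w = e^(2 pi i x/3), the right-hand
   side becomes sum_n t_n (2 cos(2 pi n/3) - 2/(1+sqrt 3)), and the left-hand
   side is this sum grouped by n mod 3, since 2/(1+sqrt 3) = sqrt 3 - 1. *)
Require Import Defs.
From Stdlib Require Import Reals ZArith List Lra Lia.
From Coquelicot Require Import Coquelicot.
Import ListNotations.

Open Scope R_scope.
Open Scope C_scope.

(** * Limits of complex sequences *)

(** Reduces complex limits to real ones, where squeezing and order arguments apply. *)
Lemma filterlim_Cmod (u : nat -> C) (l : C) :
  filterlim u eventually (locally l) <->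
  is_lim_seq (fun n => Cmod (u n - l)) 0%R.
Proof.
  split; intros H.
  - apply is_lim_seq_spec; intros eps.
    generalize (proj1 (@filterlim_locally_ball_norm C_AbsRing nat C_NormedModule
      eventually _ u l) H eps).
    apply filter_imp; intros n Hn.
    rewrite Rminus_0_r, Rabs_pos_eq by apply Cmod_ge_0.
    exact Hn.
  - apply (proj2 (@filterlim_locally_ball_norm C_AbsRing nat C_NormedModule
      eventually _ u l)); intros eps.
    generalize (proj2 (is_lim_seq_spec _ _) H eps).
    apply filter_imp; intros n Hn.
    rewrite Rminus_0_r, Rabs_pos_eq in Hn by apply Cmod_ge_0.
    exact Hn.
Qed.

Lemma Clim_unique (u : nat -> C) (l l' : C) :
  filterlim u eventually (locally l) ->
  filterlim u eventually (locally l') -> l = l'.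
Proof.
  intros H H'.
  now rewrite <- (CLim_seq_unique _ _ H), <- (CLim_seq_unique _ _ H').
Qed.

Lemma Clim_mult (u v : nat -> C) (l m : C) :
  filterlim u eventually (locally l) ->
  filterlim v eventually (locally m) ->
  filterlim (fun n => u n * v n) eventually (locally (l * m)).
Proof.
  rewrite !filterlim_Cmod; intros Hu Hv.
  apply is_lim_seq_le_le with (u := fun _ => 0%R)
    (w := fun n => (Cmod (u n - l) * Cmod (v n - m)
                    + (Cmod (u n - l) * Cmod m + Cmod l * Cmod (v n - m)))%R).
  - intros n; split; [apply Cmod_ge_0|].
    rewrite <- !Cmod_mult.
    replace (u n * v n - l * m) with ((u n - l) * (v n - m)
      + ((u n - l) * m + l * (v n - m))) by ring.
    eapply Rle_trans; [apply Cmod_triangle|].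
    apply Rplus_le_compat_l, Cmod_triangle.
  - apply is_lim_seq_const.
  - replace 0%R with (0 * 0 + (0 * Cmod m + Cmod l * 0))%R by ring.
    apply is_lim_seq_plus'; [now apply is_lim_seq_mult'|].
    apply is_lim_seq_plus'; apply is_lim_seq_mult'; trivial;
      apply is_lim_seq_const.
Qed.

Lemma Clim_Cmod_ge (u : nat -> C) (l : C) (m : R) :
  filterlim u eventually (locally l) ->
  (forall n, m <= Cmod (u n))%R -> (m <= Cmod l)%R.
Proof.
  rewrite filterlim_Cmod; intros Hu Hm.
  apply (is_lim_seq_le (fun _ => m) (fun n => Cmod (u n - l) + Cmod l)%R
    m (Cmod l)).
  - intros n; eapply Rle_trans; [apply Hm|].
    replace (u n) with (u n - l + l) at 1 by ring.
    apply Cmod_triangle.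
  - apply is_lim_seq_const.
  - replace (Cmod l) with (0 + Cmod l)%R at 1 by ring.
    apply is_lim_seq_plus'; [exact Hu|apply is_lim_seq_const].
Qed.

(** The lower bound [m] passes to the limit, so |1/u_n - 1/l| <= |u_n - l| / m^2. *)
Lemma Clim_inv (u : nat -> C) (l : C) (m : R) :
  (0 < m)%R -> (forall n, m <= Cmod (u n))%R ->
  filterlim u eventually (locally l) ->
  filterlim (fun n => / u n) eventually (locally (/ l)).
Proof.
  intros Hm Hum Hu.
  assert (Hl := Clim_Cmod_ge u l m Hu Hum).
  rewrite filterlim_Cmod in *.
  apply is_lim_seq_le_le with (u := fun _ => 0%R)
    (w := fun n => (/ m * / m * Cmod (u n - l))%R).
  - intros n; split; [apply Cmod_ge_0|].
    assert (u n <> 0) by (apply Cmod_gt_0; generalize (Hum n); lra).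
    assert (l <> 0) by (apply Cmod_gt_0; lra).
    replace (/ u n - / l) with (- (/ u n * / l * (u n - l)))
      by (field; now split).
    rewrite Cmod_opp, !Cmod_mult, !Cmod_inv by assumption.
    apply Rmult_le_compat_r; [apply Cmod_ge_0|].
    apply Rmult_le_compat; try (apply Rinv_le_contravar; auto);
    apply Rlt_le, Rinv_0_lt_compat; generalize (Hum n); lra.
  - apply is_lim_seq_const.
  - replace 0%R with (/ m * / m * 0)%R by ring.
    apply is_lim_seq_mult'; [apply is_lim_seq_const|exact Hu].
Qed.

(** * Dominated series *)

Lemma is_series_Cmod_le (u : nat -> C) (s : C) (h : nat -> R) :
  is_series u s -> (forall n, Cmod (u n) <= h n)%R -> ex_series h ->
  (Cmod s <= Series h)%R.
Proof.
  intros Hu Hh Eh.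
  assert (Hlim : is_lim_seq (fun n => Cmod (sum_n u n)) (Cmod s)).
  { exact (filterlim_comp _ _ _ (sum_n u) (@norm _ C_NormedModule) _ _ _
      Hu (filterlim_norm s)). }
  apply (is_lim_seq_le _ (sum_n h) (Cmod s) (Series h)) with (2 := Hlim).
  - intros n; induction n as [|n IH].
    + rewrite !sum_O; apply Hh.
    + rewrite !sum_Sn.
      eapply Rle_trans; [apply Cmod_triangle|].
      now apply Rplus_le_compat.
  - exact (Series_correct h Eh).
Qed.

Lemma Series_tail_lim (g : nat -> R) : ex_series g ->
  is_lim_seq (fun n => Series (fun k => g (S n + k)%nat)) 0%R.
Proof.
  intros Eg.
  apply is_lim_seq_ext with (fun n => Series g - sum_n g n)%R.
  - intros n. rewrite (Series_incr_n g (S n)) by (lia || assumption).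
    rewrite sum_n_Reals; simpl Init.Nat.pred; ring.
  - replace 0%R with (Series g - Series g)%R by ring.
    apply is_lim_seq_minus'; [apply is_lim_seq_const|].
    exact (Series_correct g Eg).
Qed.

(* Tannery's theorem. *)
Lemma is_series_dominated (u : nat -> nat -> C) (v : nat -> C) (g : nat -> R)
  (s : nat -> C) (l : C) :
  ex_series g -> (forall N n, Cmod (u N n) <= g n)%R ->
  (forall n, filterlim (fun N => u N n) eventually (locally (v n))) ->
  (forall N, is_series (u N) (s N)) -> is_series v l ->
  filterlim s eventually (locally l).
Proof.
  intros Eg Hug Huv Hs Hv.
  set (h := fun N n => Cmod (u N n - v n)).
  assert (Hvg : forall n, (Cmod (v n) <= g n)%R).
  { intros n.
    apply (is_lim_seq_le (fun N => Cmod (u N n)) (fun _ => g n) (Cmod (v n)) (g n)).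
    - intros N; apply Hug.
    - exact (filterlim_comp _ _ _ (fun N => u N n) (@norm _ C_NormedModule) _ _ _
        (Huv n) (filterlim_norm (v n))).
    - apply is_lim_seq_const. }
  assert (Hh : forall N n, (0 <= h N n <= 2 * g n)%R).
  { intros N n; split; [apply Cmod_ge_0|].
    unfold h, Cminus; eapply Rle_trans; [apply Cmod_triangle|].
    rewrite Cmod_opp; generalize (Hug N n) (Hvg n); lra. }
  assert (E2g : ex_series (fun n => 2 * g n)%R)
    by exact (ex_series_scal_l 2%R g Eg).
  assert (Eh : forall N, ex_series (h N)).
  { intros N; apply (@ex_series_le R_AbsRing R_CompleteNormedModule) with (2 := E2g).
    intros n; change (Rabs (h N n) <= 2 * g n)%R.
    rewrite Rabs_pos_eq; apply Hh. }
  assert (Hhead : forall K, is_lim_seq (fun N => sum_n (h N) K) 0%R).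
  { intros K; induction K as [|K IH].
    - apply is_lim_seq_ext with (fun N => h N 0%nat).
      + intros N; now rewrite sum_O.
      + apply (proj1 (filterlim_Cmod _ _)), Huv.
    - apply is_lim_seq_ext with (fun N => sum_n (h N) K + h N (S K))%R.
      + intros N; now rewrite sum_Sn.
      + replace 0%R with (0 + 0)%R by ring.
        apply is_lim_seq_plus'; [exact IH|].
        apply (proj1 (filterlim_Cmod _ _)), Huv. }
  apply filterlim_Cmod, is_lim_seq_spec; intros eps.
  assert (Heps : (0 < eps / 2)%R) by (destruct eps; simpl; lra).
  (* |s_N - l| is at most the sum of [h N]. First [K] makes the tail of the majorant 2g less than
     eps/2, uniformly in N; then N makes the head up to [K] less than eps/2. *)
  destruct (proj2 (is_lim_seq_spec _ _) (Series_tail_lim _ E2g)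
    (mkposreal _ Heps)) as [K HK].
  specialize (HK K (Nat.le_refl K)); simpl pos in HK.
  generalize (proj2 (is_lim_seq_spec _ _) (Hhead K) (mkposreal _ Heps)).
  apply filter_imp; intros N HN; simpl pos in HN.
  rewrite Rminus_0_r in *; rewrite Rabs_pos_eq by apply Cmod_ge_0.
  assert (H1 : (Cmod (s N - l) <= Series (h N))%R).
  { apply is_series_Cmod_le with (u := fun n => u N n - v n).
    - exact (is_series_minus (u N) v (s N) l (Hs N) Hv).
    - intros n; apply Rle_refl.
    - apply Eh. }
  rewrite (Series_incr_n (h N) (S K)) in H1 by (lia || apply Eh).
  simpl Init.Nat.pred in H1; rewrite <- sum_n_Reals in H1.
  assert (H2 : (Series (fun k => h N (S K + k)%nat)
                <= Series (fun k => 2 * g (S K + k)%nat))%R).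
  { apply Series_le; [intros n; apply Hh|].
    exact (proj1 (ex_series_incr_n (fun n => 2 * g n)%R (S K)) E2g). }
  apply Rabs_def2 in HK; apply Rabs_def2 in HN; lra.
Qed.

(** * Series over the integers *)

(** A relation carries convergence of both halves along with the value, so sums, shifts and
    regroupings compose without side conditions. *)
Definition is_ZSeries (f : Z -> C) (l : C) : Prop :=
  exists l1 l2 : C,
    is_series (fun n : nat => f (Z.of_nat n)) l1 /\
    is_series (fun n : nat => f (- Z.of_nat (S n))%Z) l2 /\ l = l1 + l2.

Lemma is_ZSeries_unique (f : Z -> C) (l : C) : is_ZSeries f l -> ZSeries f = l.
Proof.
  intros (l1 & l2 & H1 & H2 & ->); unfold ZSeries.
  now rewrite (CSeries_unique _ _ H1), (CSeries_unique _ _ H2).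
Qed.

Lemma ex_ZSeries_abs_is (f : Z -> C) : ex_ZSeries_abs f -> is_ZSeries f (ZSeries f).
Proof.
  intros H; destruct (ZSeries_abs_correct f H).
  now eexists; eexists; repeat split; eauto.
Qed.

Lemma is_ZSeries_ext (f g : Z -> C) (l : C) :
  (forall n, f n = g n) -> is_ZSeries f l -> is_ZSeries g l.
Proof.
  intros E (l1 & l2 & H1 & H2 & ->).
  exists l1, l2; repeat split.
  - apply is_series_ext with (2 := H1); intros n; apply E.
  - apply is_series_ext with (2 := H2); intros n; apply E.
Qed.

Lemma is_ZSeries_plus (f g : Z -> C) (l m : C) :
  is_ZSeries f l -> is_ZSeries g m -> is_ZSeries (fun n => f n + g n) (l + m).
Proof.
  intros (l1 & l2 & H1 & H2 & ->) (m1 & m2 & K1 & K2 & ->).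
  exists (l1 + m1), (l2 + m2); repeat split.
  - exact (is_series_plus _ _ _ _ H1 K1).
  - exact (is_series_plus _ _ _ _ H2 K2).
  - ring.
Qed.

Lemma is_ZSeries_scal (c : C) (f : Z -> C) (l : C) :
  is_ZSeries f l -> is_ZSeries (fun n => c * f n) (c * l).
Proof.
  intros (l1 & l2 & H1 & H2 & ->).
  exists (c * l1), (c * l2); repeat split.
  - exact (is_series_scal (V := C_NormedModule) c _ _ H1).
  - exact (is_series_scal (V := C_NormedModule) c _ _ H2).
  - ring.
Qed.

(** The shift moves the single term [f 0] from the non-negative half to the negative one. *)
Lemma is_ZSeries_succ (f : Z -> C) (l : C) :
  is_ZSeries f l -> is_ZSeries (fun n => f (n + 1)%Z) l.
Proof.
  intros (l1 & l2 & H1 & H2 & ->).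
  exists (l1 - f 0%Z), (l2 + f 0%Z); repeat split.
  - apply is_series_ext with (fun n => f (Z.of_nat (S n))).
    + intros n; f_equal; lia.
    + apply (is_series_incr_1 (V := C_NormedModule) (fun n => f (Z.of_nat n))).
      change (is_series (fun n => f (Z.of_nat n)) (l1 - f 0%Z + f 0%Z)).
      now replace (l1 - f 0%Z + f 0%Z) with l1 by ring.
  - apply (is_series_decr_1 (V := C_NormedModule)).
    change (is_series (fun n => f (- Z.of_nat (S (S n)) + 1)%Z)
      (l2 + f 0%Z - f 0%Z)).
    replace (l2 + f 0%Z - f 0%Z) with l2 by ring.
    apply is_series_ext with (2 := H2); intros n; f_equal; lia.
  - ring.
Qed.

Lemma is_ZSeries_pred (f : Z -> C) (l : C) :
  is_ZSeries f l -> is_ZSeries (fun n => f (n - 1)%Z) l.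
Proof.
  intros (l1 & l2 & H1 & H2 & ->).
  exists (l1 + f (-1)%Z), (l2 - f (-1)%Z); repeat split.
  - apply (is_series_decr_1 (V := C_NormedModule)).
    change (is_series (fun n => f (Z.of_nat (S n) - 1)%Z)
      (l1 + f (-1)%Z - f (-1)%Z)).
    replace (l1 + f (-1)%Z - f (-1)%Z) with l1 by ring.
    apply is_series_ext with (2 := H1); intros n; f_equal; lia.
  - apply is_series_ext with (fun n => f (- Z.of_nat (S (S n)))%Z).
    + intros n; f_equal; lia.
    + apply (is_series_incr_1 (V := C_NormedModule) (fun n => f (- Z.of_nat (S n))%Z)).
      change (is_series (fun n => f (- Z.of_nat (S n))%Z)
        (l2 - f (-1)%Z + f (-1)%Z)).
      now replace (l2 - f (-1)%Z + f (-1)%Z) with l2 by ring.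
  - ring.
Qed.

(** The grouped partial sums are the subsequence of the original ones at the indices 3n + 2. *)
Lemma is_series_group3 (u : nat -> C) (l : C) : is_series u l ->
  is_series (fun n => u (3 * n)%nat + u (3 * n + 1)%nat + u (3 * n + 2)%nat) l.
Proof.
  intros H.
  apply (filterlim_ext (fun n => sum_n u (3 * n + 2))).
  - intros n; induction n as [|n IH].
    + simpl; now rewrite !sum_Sn, !sum_O.
    + rewrite sum_Sn, <- IH.
      replace (3 * S n + 2)%nat with (S (S (S (3 * n + 2)))) by lia.
      rewrite !sum_Sn, <- !plus_assoc.
      replace (S (3 * n + 2)) with (3 * S n)%nat by lia.
      replace (S (3 * S n)) with (3 * S n + 1)%nat by lia.
      replace (S (3 * S n + 1)) with (3 * S n + 2)%nat by lia.
      apply f_equal, (Cplus_assoc (u _) (u _) (u _)).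
  - apply filterlim_comp with (2 := H).
    intros P [N HN]; exists N; intros n Hn; apply HN; lia.
Qed.

(** The blocks with m >= 0 tile n >= 0 and those with m < 0 tile n < 0, so the two halves do not
    mix. *)
Lemma is_ZSeries_group3 (f : Z -> C) (l : C) : is_ZSeries f l ->
  is_ZSeries (fun m => f (3 * m)%Z + f (3 * m + 1)%Z + f (3 * m + 2)%Z) l.
Proof.
  intros (l1 & l2 & H1 & H2 & ->).
  exists l1, l2; repeat split.
  - apply is_series_ext with (2 := is_series_group3 _ _ H1); intros n.
    f_equal; [f_equal|]; f_equal; lia.
  - apply is_series_ext with (2 := is_series_group3 _ _ H2); intros n.
    (* The negative half runs downwards, so each of its blocks is read in reverse order. *)
    transitivity (f (- Z.of_nat (S (3 * n + 2)))%Z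
      + f (- Z.of_nat (S (3 * n + 1)))%Z + f (- Z.of_nat (S (3 * n)))%Z).
    + match goal with |- ?l = ?r => change (@eq C l r) end; ring.
    + f_equal; [f_equal|]; f_equal; lia.
Qed.

(** Meant for subseries along k(m) = 3m, 3m + 1, 3m - 1: since |m| <= |k(m)|, the geometric majorant
    survives the reindexing. *)
Lemma ex_ZSeries_abs_geom (f : Z -> C) (k : Z -> Z) (D : R) :
  (forall n, Cmod (f n) <= D * (1 / 2) ^ Z.abs_nat n)%R ->
  (forall n, Z.abs_nat n <= Z.abs_nat (k n))%nat ->
  ex_ZSeries_abs (fun n => f (k n)).
Proof.
  intros H Hk.
  assert (HD : (0 <= D)%R).
  { specialize (H 0%Z); change (Z.abs_nat 0) with 0%nat in H.
    rewrite pow_O, Rmult_1_r in H.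
    exact (Rle_trans _ _ _ (Cmod_ge_0 _) H). }
  assert (K : forall j : nat -> Z, (forall n, n <= Z.abs_nat (j n))%nat ->
    ex_series (fun n => Cmod (f (k (j n))))).
  { intros j Hj.
    apply (@ex_series_le R_AbsRing R_CompleteNormedModule)
      with (fun n => D * (1 / 2) ^ n)%R.
    - intros n; change (Rabs (Cmod (f (k (j n)))) <= D * (1 / 2) ^ n)%R.
      rewrite Rabs_pos_eq by apply Cmod_ge_0.
      eapply Rle_trans; [apply H|].
      apply Rmult_le_compat_l; [exact HD|].
      replace (Z.abs_nat (k (j n))) with (n + (Z.abs_nat (k (j n)) - n))%nat
        by (specialize (Hj n); specialize (Hk (j n)); lia).
      rewrite pow_add.
      rewrite <- (Rmult_1_r ((1 / 2) ^ n)%R) at 2.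
      apply Rmult_le_compat_l; [apply pow_le; lra|].
      eapply Rle_trans; [apply (pow_incr _ 1); lra|].
      rewrite pow1; apply Rle_refl.
    - apply (ex_series_scal_l (V := R_NormedModule) D (fun n => (1 / 2) ^ n)%R).
      apply ex_series_geom; rewrite Rabs_pos_eq; lra. }
  split; apply K; intros n; lia.
Qed.

Lemma is_ZSeries_dominated (u : nat -> Z -> C) (v : Z -> C) (g : Z -> R)
  (s : nat -> C) (l : C) :
  ex_series (fun n => g (Z.of_nat n)) ->
  ex_series (fun n => g (- Z.of_nat (S n))%Z) ->
  (forall N n, Cmod (u N n) <= g n)%R ->
  (forall n, filterlim (fun N => u N n) eventually (locally (v n))) ->
  (forall N, is_ZSeries (u N) (s N)) -> is_ZSeries v l ->
  filterlim s eventually (locally l).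
Proof.
  intros Eg1 Eg2 Hug Huv Hs (l1 & l2 & Hl1 & Hl2 & ->).
  apply (filterlim_ext (fun N => ZSeries (u N))).
  { intros N; now apply is_ZSeries_unique. }
  apply (filterlim_comp_2 (G := locally l1) (H := locally l2)
    (fun N => CSeries (fun n => u N (Z.of_nat n)))
    (fun N => CSeries (fun n => u N (- Z.of_nat (S n))%Z)) Cplus).
  - apply (is_series_dominated (fun N n => u N (Z.of_nat n))
      (fun n => v (Z.of_nat n)) (fun n => g (Z.of_nat n)));
      [exact Eg1|intros N n; apply Hug|intros n; apply Huv| |exact Hl1].
    intros N; destruct (Hs N) as (m1 & m2 & H1 & H2 & _).
    now rewrite (CSeries_unique _ _ H1).
  - apply (is_series_dominated (fun N n => u N (- Z.of_nat (S n))%Z)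
      (fun n => v (- Z.of_nat (S n))%Z) (fun n => g (- Z.of_nat (S n))%Z));
      [exact Eg2|intros N n; apply Hug|intros n; apply Huv| |exact Hl2].
    intros N; destruct (Hs N) as (m1 & m2 & H1 & H2 & _).
    now rewrite (CSeries_unique _ _ H2).
  - exact (filterlim_plus (V := C_NormedModule) l1 l2).
Qed.

(** * Bounds and convergence of the q-products *)

(** By 1 + t <= e^t, the growth factors multiply to at most the exponential of a geometric sum. *)
Lemma prod_growth_bound (X : nat -> R) (c r : R) :
  (0 <= r < 1)%R -> (0 <= c)%R -> (X 0%nat <= 1)%R ->
  (forall n, X (S n) <= X n * (1 + c * r ^ n))%R ->
  forall n, (X n <= exp (c / (1 - r)))%R.
Proof.
  intros Hr Hc H0 HS.
  assert (Hpow : forall n, (0 <= r ^ n)%R) by (intros n; apply pow_le; lra).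
  (* The exponent is the partial sum c (1 + r + ... + r^(n-1)); in this sharper form the induction
     closes. *)
  assert (K : forall n, (X n <= exp (c * (1 - r ^ n) / (1 - r)))%R).
  { intros n; induction n as [|n IH].
    - replace (c * (1 - r ^ 0) / (1 - r))%R with 0%R by (simpl; field; lra).
      now rewrite exp_0.
    - eapply Rle_trans; [apply HS|].
      replace (c * (1 - r ^ S n) / (1 - r))%R
        with (c * (1 - r ^ n) / (1 - r) + c * r ^ n)%R by (simpl; field; lra).
      assert (0 <= c * r ^ n)%R by (apply Rmult_le_pos; auto).
      rewrite exp_plus.
      apply Rle_trans with (exp (c * (1 - r ^ n) / (1 - r)) * (1 + c * r ^ n))%R.
      + apply Rmult_le_compat_r; lra.
      + apply Rmult_le_compat_l; [apply Rlt_le, exp_pos|].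
        apply exp_ineq1_le. }
  intros n; eapply Rle_trans; [apply K|].
  assert (E : (c * (1 - r ^ n) / (1 - r) <= c / (1 - r))%R).
  { apply Rmult_le_compat_r; [apply Rlt_le, Rinv_0_lt_compat; lra|].
    rewrite <- (Rmult_1_r c) at 2; apply Rmult_le_compat_l; [lra|].
    generalize (Hpow n); lra. }
  destruct E as [E|E]; [now apply Rlt_le, exp_increasing|rewrite E; lra].
Qed.

Lemma qprod_le (alpha q : C) (n : nat) : (Cmod q < 1)%R ->
  (Cmod (qprod alpha q n) <= exp (Cmod alpha / (1 - Cmod q)))%R.
Proof.
  intros Hq.
  apply (prod_growth_bound (fun n => Cmod (qprod alpha q n))).
  - split; [apply Cmod_ge_0|exact Hq].
  - apply Cmod_ge_0.
  - change (Cmod 1 <= 1)%R; rewrite Cmod_1; lra.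
  - intros k; change (qprod alpha q (S k))
      with (qprod alpha q k * (1 - alpha * q ^ k)); rewrite Cmod_mult.
    apply Rmult_le_compat_l; [apply Cmod_ge_0|].
    unfold Cminus; eapply Rle_trans; [apply Cmod_triangle|].
    rewrite Cmod_opp, Cmod_1, Cmod_mult, Cmod_pow; lra.
Qed.

(** Consecutive partial products differ by -[qprod alpha q n] alpha q^n, which is geometrically
    small because the products are bounded. Telescoping uses no logarithms, so vanishing factors are
    covered. *)
Lemma ex_qPoch_lt_1 (alpha q : C) : (Cmod q < 1)%R -> ex_qPoch alpha q.
Proof.
  intros Hq.
  (* The initial term 1 is the empty product, so the n-th partial sum of [d] is exactly
     [qprod alpha q n]. *)
  set (d := fun n => match n with
    | O => RtoC 1 | S k => qprod alpha q (S k) - qprod alpha q k end).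
  assert (Hd : ex_series d).
  { apply (ex_series_incr_1 (V := C_NormedModule)).
    apply (@ex_series_le C_AbsRing C_CompleteNormedModule) with
      (fun n => exp (Cmod alpha / (1 - Cmod q)) * Cmod alpha * Cmod q ^ n)%R.
    - intros n; change (Cmod (qprod alpha q (S n) - qprod alpha q n)
        <= exp (Cmod alpha / (1 - Cmod q)) * Cmod alpha * Cmod q ^ n)%R.
      replace (qprod alpha q (S n) - qprod alpha q n)
        with (- (qprod alpha q n * alpha * q ^ n))
        by (unfold qprod; simpl Cprod; ring).
      rewrite Cmod_opp, !Cmod_mult, Cmod_pow.
      apply Rmult_le_compat_r; [apply pow_le, Cmod_ge_0|].
      apply Rmult_le_compat_r; [apply Cmod_ge_0|].
      now apply qprod_le.
    - apply (ex_series_scal_l (V := R_NormedModule) _ (fun n => Cmod q ^ n)%R).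
      apply ex_series_geom; rewrite Rabs_pos_eq; [exact Hq|apply Cmod_ge_0]. }
  destruct Hd as [l Hl]; exists l.
  apply (filterlim_ext (sum_n d)) with (2 := Hl).
  intros n; induction n as [|n IH].
  - now rewrite sum_O.
  - rewrite sum_Sn, IH.
    change (qprod alpha q n + (qprod alpha q (S n) - qprod alpha q n)
      = qprod alpha q (S n)); ring.
Qed.

Lemma qPoch_lim (alpha q : C) : (Cmod q < 1)%R ->
  filterlim (qprod alpha q) eventually (locally (qPoch alpha q)).
Proof.
  intros Hq; destruct (ex_qPoch_lt_1 alpha q Hq) as [l Hl].
  unfold qPoch; now rewrite (CLim_seq_unique _ _ Hl).
Qed.

(** * The products (q)_n, their reciprocals and the q-Pascal rule *)

Lemma qprod_self_neq_0 (q : C) (n : nat) : (Cmod q < 1)%R -> qprod q q n <> 0.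
Proof.
  intros Hq; induction n as [|n IH]; unfold qprod; simpl.
  - intros E; apply (f_equal fst) in E; simpl in E; lra.
  - apply Cmult_neq_0; [exact IH|].
    rewrite <- Cpow_S; intros E.
    assert (H : q ^ S n = 1).
    { replace (q ^ S n) with (1 - (1 - q ^ S n)) by ring; rewrite E; ring. }
    apply (f_equal Cmod) in H; rewrite Cmod_1, Cmod_pow in H.
    assert (H1 := pow_lt_1_compat (Cmod q) (S n)
      (conj (Cmod_ge_0 q) Hq) (Nat.lt_0_succ n)); lra.
Qed.

(** [prod_growth_bound] is applied to the reciprocals with r = |q| and c = r/(1 - r), which explains
    the two divisions by 1 - r. *)
Lemma qprod_self_ge (q : C) (n : nat) : (Cmod q < 1)%R ->
  (/ exp (Cmod q / (1 - Cmod q) / (1 - Cmod q)) <= Cmod (qprod q q n))%R.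
Proof.
  intros Hq.
  assert (Hp : forall k, (0 < Cmod (qprod q q k))%R).
  { intros k; now apply Cmod_gt_0, qprod_self_neq_0. }
  rewrite <- (Rinv_inv (Cmod (qprod q q n))).
  apply Rinv_le_contravar; [now apply Rinv_0_lt_compat|].
  assert (Hr := Cmod_ge_0 q); set (r := Cmod q) in *.
  apply (prod_growth_bound (fun n => / Cmod (qprod q q n))%R).
  - now split.
  - apply Rmult_le_pos; [exact Hr|apply Rlt_le, Rinv_0_lt_compat; lra].
  - change (/ Cmod 1 <= 1)%R; rewrite Cmod_1; lra.
  - intros k; change (qprod q q (S k)) with (qprod q q k * (1 - q * q ^ k)).
    rewrite Cmod_mult, Rinv_mult.
    apply Rmult_le_compat_l; [now apply Rlt_le, Rinv_0_lt_compat|].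
    assert (Hrk : (0 <= r ^ k)%R) by now apply pow_le.
    assert (Hrk1 : (r ^ k <= 1)%R).
    { rewrite <- (pow1 k); apply pow_incr; lra. }
    (* 1/(1-s) = 1 + s/(1-s) <= 1 + s/(1-r) for s = r^(k+1) <= r *)
    apply Rle_trans with (/ (1 - r * r ^ k))%R.
    + apply Rinv_le_contravar; [nra|].
      assert (H := Cmod_triangle (1 - q * q ^ k) (q * q ^ k)).
      replace (1 - q * q ^ k + q * q ^ k) with (RtoC 1) in H by ring.
      rewrite Cmod_1, Cmod_mult, Cmod_pow in H; fold r in H; lra.
    + apply Rmult_le_reg_l with (1 - r * r ^ k)%R; [nra|].
      rewrite Rinv_r by nra.
      apply Rmult_le_reg_l with (1 - r)%R; [lra|].
      replace ((1 - r) * ((1 - r * r ^ k) * (1 + r / (1 - r) * r ^ k)))%R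
        with ((1 - r * r ^ k) * (1 - r + r * r ^ k))%R by (field; lra).
      assert (0 <= r * r ^ k)%R by (apply Rmult_le_pos; lra).
      assert (r * r ^ k <= r)%R by nra.
      nra.
Qed.

(* 1/(q;q)_k, extended by its natural value 0 to k < 0. *)
Definition inv_qfact (q : C) (k : Z) : C :=
  if (k <? 0)%Z then 0 else / qprod q q (Z.to_nat k).

Lemma inv_qfact_neg (q : C) (k : Z) : (k < 0)%Z -> inv_qfact q k = 0.
Proof. intros H; unfold inv_qfact; now apply Z.ltb_lt in H as ->. Qed.

(** For k > 0 this is (q)_k = (q)_(k-1) (1 - q^k). For k <= 0 the truncated power is q^0, so the
    factor vanishes in accordance with the extension by 0. *)
Lemma inv_qfact_pred (q : C) (k : Z) : (Cmod q < 1)%R ->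
  inv_qfact q (k - 1) = (1 - q ^ Z.to_nat k) * inv_qfact q k.
Proof.
  intros Hq.
  destruct (Z_le_gt_dec k 0) as [Hk|Hk].
  - rewrite inv_qfact_neg by lia.
    replace (Z.to_nat k) with 0%nat by lia; simpl; ring.
  - unfold inv_qfact.
    rewrite !(proj2 (Z.ltb_ge _ _)) by lia.
    replace (Z.to_nat k) with (S (Z.to_nat (k - 1))) by lia.
    assert (H := qprod_self_neq_0 q (S (Z.to_nat (k - 1))) Hq).
    assert (H' := qprod_self_neq_0 q (Z.to_nat (k - 1)) Hq).
    unfold qprod in H |- *; simpl in H |- *; fold (qprod q q (Z.to_nat (k - 1))) in *.
    field; split; [|exact H'].
    intros E; apply H; rewrite E; ring.
Qed.

Lemma inv_qfact_le (q : C) (k : Z) : (Cmod q < 1)%R ->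
  (Cmod (inv_qfact q k) <= exp (Cmod q / (1 - Cmod q) / (1 - Cmod q)))%R.
Proof.
  intros Hq; unfold inv_qfact; destruct (k <? 0)%Z.
  - rewrite Cmod_0; apply Rlt_le, exp_pos.
  - rewrite Cmod_inv by now apply qprod_self_neq_0.
    rewrite <- Rinv_inv; apply Rinv_le_contravar.
    + apply Rinv_0_lt_compat, exp_pos.
    + now apply qprod_self_ge.
Qed.

(** The lower bound on |(q)_n| is uniform in n, hence survives in the limit. *)
Lemma qPoch_self_neq_0 (q : C) : (Cmod q < 1)%R -> qPoch q q <> 0.
Proof.
  intros Hq; apply Cmod_gt_0.
  eapply Rlt_le_trans; [|apply (Clim_Cmod_ge _ _ _ (qPoch_lim q q Hq))].
  - apply Rinv_0_lt_compat, exp_pos.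
  - intros n; now apply qprod_self_ge.
Qed.

Lemma inv_qfact_lim (q : C) (n : Z) : (Cmod q < 1)%R ->
  filterlim (fun N => inv_qfact q (Z.of_nat N + n)) eventually
    (locally (/ qPoch q q)).
Proof.
  intros Hq.
  apply filterlim_ext_loc with (fun N => / qprod q q (Z.to_nat (Z.of_nat N + n))).
  (* From N = |n| on, the index N + n is non-negative and the extension by 0 is out of play. *)
  - exists (Z.abs_nat n); intros N HN; unfold inv_qfact.
    now rewrite (proj2 (Z.ltb_ge _ _)) by lia.
  - apply (filterlim_comp _ _ _ (fun N => Z.to_nat (Z.of_nat N + n))
      (fun k => / qprod q q k) _ eventually).
    + intros P [K HK]; exists (K + Z.abs_nat n)%nat; intros N HN; apply HK; lia.
    + apply Clim_inv with (/ exp (Cmod q / (1 - Cmod q) / (1 - Cmod q)))%R.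
      * apply Rinv_0_lt_compat, exp_pos.
      * intros k; now apply qprod_self_ge.
      * now apply qPoch_lim.
Qed.

(* The q-Pascal rule for [m, i] = (q)_m / ((q)_i (q)_(m-i)). *)
Lemma q_pascal (q : C) (m : nat) (i j : Z) : (Cmod q < 1)%R ->
  (0 <= i)%Z -> (i + j = Z.of_nat (S m))%Z ->
  qprod q q (S m) * inv_qfact q i * inv_qfact q j =
  qprod q q m * (inv_qfact q (i - 1) * inv_qfact q j
                 + q ^ Z.to_nat i * inv_qfact q i * inv_qfact q (j - 1)).
Proof.
  intros Hq Hi Hij.
  destruct (Z_lt_le_dec j 0) as [Hj|Hj].
  - rewrite !(inv_qfact_neg q j), (inv_qfact_neg q (j - 1)) by lia; ring.
  (* With the common factors removed, what remains is 1 - q^(i+j) = (1 - q^i) + q^i (1 - q^j). *)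
  - rewrite !inv_qfact_pred by assumption.
    change (qprod q q (S m)) with (qprod q q m * (1 - q * q ^ m)).
    rewrite <- Cpow_S.
    replace (S m) with (Z.to_nat i + Z.to_nat j)%nat by lia.
    rewrite Cpow_add_r; ring.
Qed.

(** * The exponential and the theta terms *)

Lemma Cexp_plus (y z : C) : Cexp (y + z) = Cexp y * Cexp z.
Proof.
  unfold Cexp, Cmult, Re, Im; simpl; rewrite exp_plus, cos_plus, sin_plus.
  f_equal; ring.
Qed.

Lemma Cexp_0 : Cexp 0 = 1.
Proof. unfold Cexp, RtoC; simpl; rewrite exp_0, cos_0, sin_0; f_equal; ring. Qed.

(** This is t_n with z = e^y; carrying [y] gives z^n for negative n without inverses. Both
    triangular exponents are non-negative, so [Z.to_nat] loses nothing. *)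
Definition theta_term (a b y : C) (n : Z) : C :=
  a ^ Z.to_nat (n * (n + 1) / 2) * b ^ Z.to_nat (n * (n - 1) / 2)
  * Cexp (IZR n * y).

Lemma triangular_succ (n : Z) : (n * (n + 1) / 2 = n + n * (n - 1) / 2)%Z.
Proof.
  rewrite <- Z.div_add_l by lia; f_equal; ring.
Qed.

Lemma triangular_nonneg (n : Z) : (0 <= n * (n - 1) / 2)%Z.
Proof. apply Z.div_pos; nia. Qed.

(** Formally t_n = a z q^(n-1) t_(n-1) with q = ab; the multiplier q^(M+1-n) keeps all exponents
    non-negative. *)
Lemma theta_term_succ (a b y : C) (M : nat) (n : Z) :
  (n <= Z.of_nat (S M))%Z ->
  (a * b) ^ M * (a * Cexp y) * theta_term a b y (n - 1)
  = (a * b) ^ Z.to_nat (Z.of_nat (S M) - n) * theta_term a b y n.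
Proof.
  intros Hn; unfold theta_term.
  replace (IZR n * y) with (y + IZR (n - 1) * y)
    by (rewrite minus_IZR, RtoC_minus; ring).
  rewrite Cexp_plus, !Cpow_mult_l.
  replace ((n - 1) * (n - 1 + 1))%Z with (n * (n - 1))%Z by ring.
  assert (E1 := triangular_succ n).
  assert (E2 := triangular_succ (n - 1)).
  replace ((n - 1) * (n - 1 + 1))%Z with (n * (n - 1))%Z in E2 by ring.
  assert (P1 := triangular_nonneg n).
  assert (P2 := triangular_nonneg (n - 1)).
  assert (P3 := triangular_nonneg (n + 1)).
  replace ((n + 1) * (n + 1 - 1))%Z with (n * (n + 1))%Z in P3 by ring.
  set (s := Z.to_nat (Z.of_nat (S M) - n)).
  set (A1 := (n * (n + 1) / 2)%Z) in *.
  set (A0 := (n * (n - 1) / 2)%Z) in *.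
  set (A2 := ((n - 1) * (n - 1 - 1) / 2)%Z) in *.
  (* [A0] is both the exponent of a in t_(n-1) and that of b in t_n. The exponents match because
     [A1] = n + [A0] and [A0] = n - 1 + [A2]. *)
  transitivity (a ^ (S M + Z.to_nat A0) * b ^ (M + Z.to_nat A2)
    * (Cexp y * Cexp (IZR (n - 1) * y))).
  - rewrite !Cpow_add_r, Cpow_S; ring.
  - replace (S M + Z.to_nat A0)%nat with (s + Z.to_nat A1)%nat by lia.
    replace (M + Z.to_nat A2)%nat with (s + Z.to_nat A0)%nat by lia.
    rewrite !Cpow_add_r; ring.
Qed.

(** This symmetry z -> 1/z transfers facts about the a-factors and n >= 0 to the b-factors and n <=
    0. *)
Lemma theta_term_swap (a b y : C) (n : Z) :
  theta_term a b y n = theta_term b a (- y) (- n).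
Proof.
  unfold theta_term.
  replace (- n * (- n + 1))%Z with (n * (n - 1))%Z by ring.
  replace (- n * (- n - 1))%Z with (n * (n + 1))%Z by ring.
  replace (IZR (- n) * - y) with (IZR n * y) by (rewrite opp_IZR, RtoC_opp; ring).
  ring.
Qed.

Lemma theta_term_pred (a b y : C) (N : nat) (n : Z) :
  (- n <= Z.of_nat (S N))%Z ->
  (a * b) ^ N * (b * Cexp (- y)) * theta_term a b y (n + 1)
  = (a * b) ^ Z.to_nat (Z.of_nat (S N) + n) * theta_term a b y n.
Proof.
  intros Hn.
  rewrite !(theta_term_swap a b y), (Cmult_comm a b).
  replace (- (n + 1))%Z with (- n - 1)%Z by ring.
  rewrite theta_term_succ by assumption.
  now replace (Z.of_nat (S N) - - n)%Z with (Z.of_nat (S N) + n)%Z by ring.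
Qed.

(** * The finite form of the triple product *)

Lemma is_series_zero : is_series (fun _ : nat => RtoC 0) (RtoC 0).
Proof.
  apply (filterlim_ext (fun _ => RtoC 0)); [|apply filterlim_const].
  intros n; induction n as [|n IH]; [now rewrite sum_O|].
  rewrite sum_Sn, <- IH; symmetry; exact (Cplus_0_l 0).
Qed.

Lemma is_ZSeries_single (f : Z -> C) :
  (forall n, n <> 0%Z -> f n = 0) -> is_ZSeries f (f 0%Z).
Proof.
  intros Hf; exists (f 0%Z), 0; repeat split.
  - apply (is_series_decr_1 (V := C_NormedModule)).
    change (is_series (fun n => f (Z.of_nat (S n))) (f 0%Z - f 0%Z)).
    replace (f 0%Z - f 0%Z) with (RtoC 0) by ring.
    apply is_series_ext with (2 := is_series_zero).
    intros n; symmetry; apply Hf; lia.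
  - apply is_series_ext with (2 := is_series_zero).
    intros n; symmetry; apply Hf; lia.
  - ring.
Qed.

(** The extension of 1/(q)_k by 0 confines the support to -N <= n <= M, so a finite sum can be
    handled as a series over all integers. Separate M and N let each induction step add a single
    factor. *)
Lemma finite_jacobi_triple (a b y : C) (M N : nat) : (Cmod (a * b) < 1)%R ->
  is_ZSeries (fun n => qprod (a * b) (a * b) (M + N)
      * inv_qfact (a * b) (Z.of_nat M - n) * inv_qfact (a * b) (Z.of_nat N + n)
      * theta_term a b y n)
    (qprod (- a * Cexp y) (a * b) M * qprod (- b * Cexp (- y)) (a * b) N).
Proof.
  intros Hq; set (q := a * b) in *.
  induction M as [|M IHM]; [induction N as [|N IHN]|].
  - set (f := fun n : Z => _).
    replace (qprod _ _ _ * qprod _ _ _) with (f 0%Z).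
    + apply is_ZSeries_single; intros n Hn; unfold f.
      destruct (Z_lt_le_dec n 0).
      * rewrite (inv_qfact_neg _ (Z.of_nat 0 + n)) by lia; ring.
      * rewrite (inv_qfact_neg _ (Z.of_nat 0 - n)) by lia; ring.
    + unfold f, theta_term, inv_qfact; simpl.
      rewrite Cmult_0_l, Cexp_0; unfold qprod; simpl; field.
  - change (qprod (- b * Cexp (- y)) q (S N)) with
      (qprod (- b * Cexp (- y)) q N * (1 - - b * Cexp (- y) * q ^ N)).
    replace (_ * (_ * (1 - _))) with
      (qprod (- a * Cexp y) q 0 * qprod (- b * Cexp (- y)) q N
       + q ^ N * (b * Cexp (- y))
         * (qprod (- a * Cexp y) q 0 * qprod (- b * Cexp (- y)) q N)) by ring.
    apply is_ZSeries_ext with (2 := is_ZSeries_plus _ _ _ _ IHN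
      (is_ZSeries_scal _ _ _ (is_ZSeries_succ _ _ IHN))).
    intros n; cbv beta.
    (* Below the support every term is 0; otherwise N + 1 + n >= 0, as the recurrences require. *)
    destruct (Z_lt_le_dec (Z.of_nat (S N) + n) 0).
    + rewrite !(inv_qfact_neg q (_ + _)) by lia; ring.
    + replace (0 + S N)%nat with (S (0 + N)) by lia.
      set (c := qprod q q (0 + N)).
      (* The two summands of q-Pascal appear with i = N + 1 + n and j = -n. *)
      transitivity (c * (inv_qfact q (Z.of_nat (S N) + n - 1)
          * inv_qfact q (Z.of_nat 0 - n) * theta_term a b y n
        + inv_qfact q (Z.of_nat (S N) + n) * inv_qfact q (Z.of_nat 0 - n - 1)
          * (q ^ N * (b * Cexp (- y)) * theta_term a b y (n + 1)))).
      * replace (Z.of_nat (S N) + n - 1)%Z with (Z.of_nat N + n)%Z by lia.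
        replace (Z.of_nat N + (n + 1))%Z with (Z.of_nat (S N) + n)%Z by lia.
        replace (Z.of_nat 0 - (n + 1))%Z with (Z.of_nat 0 - n - 1)%Z by lia.
        ring.
      * assert (Hpred := theta_term_pred a b y N n ltac:(lia)).
        fold q in Hpred; rewrite Hpred.
        transitivity (qprod q q (S (0 + N)) * inv_qfact q (Z.of_nat (S N) + n)
          * inv_qfact q (Z.of_nat 0 - n) * theta_term a b y n); [|ring].
        rewrite q_pascal by (assumption || lia); fold c; ring.
  - change (qprod (- a * Cexp y) q (S M)) with
      (qprod (- a * Cexp y) q M * (1 - - a * Cexp y * q ^ M)).
    replace (_ * (1 - _) * _) with
      (qprod (- a * Cexp y) q M * qprod (- b * Cexp (- y)) q N
       + q ^ M * (a * Cexp y)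
         * (qprod (- a * Cexp y) q M * qprod (- b * Cexp (- y)) q N)) by ring.
    apply is_ZSeries_ext with (2 := is_ZSeries_plus _ _ _ _ IHM
      (is_ZSeries_scal _ _ _ (is_ZSeries_pred _ _ IHM))).
    intros n; cbv beta.
    destruct (Z_lt_le_dec (Z.of_nat (S M) - n) 0).
    + rewrite !(inv_qfact_neg q (_ - _)) by lia; ring.
    + replace (S M + N)%nat with (S (M + N)) by lia.
      set (c := qprod q q (M + N)).
      (* Here q-Pascal is used with i = M + 1 - n and j = N + n. *)
      transitivity (c * (inv_qfact q (Z.of_nat (S M) - n - 1)
          * inv_qfact q (Z.of_nat N + n) * theta_term a b y n
        + inv_qfact q (Z.of_nat (S M) - n) * inv_qfact q (Z.of_nat N + n - 1)
          * (q ^ M * (a * Cexp y) * theta_term a b y (n - 1)))).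
      * replace (Z.of_nat (S M) - n - 1)%Z with (Z.of_nat M - n)%Z by lia.
        replace (Z.of_nat M - (n - 1))%Z with (Z.of_nat (S M) - n)%Z by lia.
        replace (Z.of_nat N + (n - 1))%Z with (Z.of_nat N + n - 1)%Z by lia.
        ring.
      * assert (Hsucc := theta_term_succ a b y M n ltac:(lia)).
        fold q in Hsucc; rewrite Hsucc.
        rewrite q_pascal by (assumption || lia); fold c; ring.
Qed.

(** * Decay of the theta terms and the triple product *)

(** The ratio bound r^n A tends to 0, so 2^n u_n stops growing after finitely many steps. *)
Lemma gaussian_growth_bound (u : nat -> R) (r A : R) :
  (0 <= r < 1)%R -> (0 <= A)%R -> (forall n, 0 <= u n)%R ->
  (forall n, u (S n) <= r ^ n * A * u n)%R ->
  exists D, forall n, (u n <= D * (1 / 2) ^ n)%R.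
Proof.
  intros Hr HA Hu HS.
  assert (Hr1 : (Rabs r < 1)%R) by (rewrite Rabs_pos_eq; lra).
  assert (Hpow : forall n, (0 <= r ^ n)%R) by (intros n; apply pow_le; lra).
  (* Once r^n is below this threshold, the ratio bound 2 A r^n of [v] is at most 1; the added 1
     covers A = 0. *)
  assert (Heps : (0 < / (2 * A + 1))%R) by (apply Rinv_0_lt_compat; lra).
  destruct (proj2 (is_lim_seq_spec _ _) (is_lim_seq_geom r Hr1)
    (mkposreal _ Heps)) as [K HK]; simpl pos in HK.
  set (v := fun n => (u n * 2 ^ n)%R).
  assert (Hv : forall n, (0 <= v n)%R)
    by (intros n; apply Rmult_le_pos; [apply Hu|apply pow_le; lra]).
  assert (HvS : forall n, (v (S n) <= r ^ n * (2 * A) * v n)%R).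
  { intros n; unfold v; simpl.
    replace (r ^ n * (2 * A) * (u n * 2 ^ n))%R
      with (r ^ n * A * u n * (2 * 2 ^ n))%R by ring.
    apply Rmult_le_compat_r; [|apply HS].
    apply Rmult_le_pos; [lra|apply pow_le; lra]. }
  (* A crude bound for the steps before [K], from r^n <= 1. *)
  assert (H1 : forall n, (v n <= u 0%nat * (1 + 2 * A) ^ n)%R).
  { intros n; induction n as [|n IH]; [unfold v; simpl; lra|].
    eapply Rle_trans; [apply HvS|]; simpl.
    assert (r ^ n <= 1)%R.
    { eapply Rle_trans; [apply (pow_incr r 1); lra|rewrite pow1; lra]. }
    replace (u 0%nat * ((1 + 2 * A) * (1 + 2 * A) ^ n))%R
      with ((1 + 2 * A) * (u 0%nat * (1 + 2 * A) ^ n))%R by ring.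
    apply Rmult_le_compat; auto.
    - apply Rmult_le_pos; [auto|lra].
    - specialize (Hpow n); nra. }
  assert (H2 : forall n, (v (K + n)%nat <= u 0%nat * (1 + 2 * A) ^ K)%R).
  { intros n; induction n as [|n IH].
    - rewrite Nat.add_0_r; apply H1.
    - rewrite Nat.add_succ_r; eapply Rle_trans; [apply HvS|].
      eapply Rle_trans; [|exact IH].
      rewrite <- (Rmult_1_l (v (K + n)%nat)) at 2.
      apply Rmult_le_compat_r; [apply Hv|].
      specialize (HK (K + n)%nat (Nat.le_add_r _ _)).
      rewrite Rminus_0_r, Rabs_pos_eq in HK by auto.
      apply Rle_trans with (/ (2 * A + 1) * (2 * A + 1))%R.
      + apply Rmult_le_compat; try lra; auto.
      + rewrite Rinv_l; lra. }
  assert (H3 : forall n, (v n <= u 0%nat * (1 + 2 * A) ^ K)%R).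
  { intros n; destruct (Nat.le_gt_cases K n) as [H|H].
    - replace n with (K + (n - K))%nat by lia; apply H2.
    - eapply Rle_trans; [apply H1|].
      apply Rmult_le_compat_l; [apply Hu|].
      apply Rle_pow; [lra|lia]. }
  exists (u 0%nat * (1 + 2 * A) ^ K)%R; intros n.
  replace (u n) with (v n * (1 / 2) ^ n)%R.
  - apply Rmult_le_compat_r; [apply pow_le; lra|apply H3].
  - unfold v; rewrite Rmult_assoc, <- Rpow_mult_distr.
    replace (2 * (1 / 2))%R with 1%R by field; rewrite pow1; ring.
Qed.

Lemma theta_term_geom (a b y : C) : (Cmod (a * b) < 1)%R ->
  exists D, forall n, (Cmod (theta_term a b y n) <= D * (1 / 2) ^ Z.abs_nat n)%R.
Proof.
  intros Hq.
  assert (K : forall a b y, (Cmod (a * b) < 1)%R -> exists D, forall n : nat,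
    (Cmod (theta_term a b y (Z.of_nat n)) <= D * (1 / 2) ^ n)%R).
  { clear; intros a b y Hq.
    apply (gaussian_growth_bound
      (fun n => Cmod (theta_term a b y (Z.of_nat n)))
      (Cmod (a * b)) (Cmod (a * Cexp y))).
    - split; [apply Cmod_ge_0|exact Hq].
    - apply Cmod_ge_0.
    - intros n; apply Cmod_ge_0.
    - intros n.
      (* At the extreme index the multiplier is q^0, which leaves t_(n+1) = q^n a z t_n. *)
      assert (H := theta_term_succ a b y n (Z.of_nat (S n)) (Z.le_refl _)).
      rewrite Z.sub_diag in H; simpl Z.to_nat in H.
      replace (Z.of_nat (S n) - 1)%Z with (Z.of_nat n) in H by lia.
      apply Req_le; rewrite <- Cmod_pow, <- !Cmod_mult, H.
      simpl; now rewrite Cmult_1_l. }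
  destruct (K a b y Hq) as [D1 H1].
  rewrite Cmult_comm in Hq; destruct (K b a (- y) Hq) as [D2 H2].
  exists (Rmax D1 D2); intros n.
  assert (Hp : (0 <= (1 / 2) ^ Z.abs_nat n)%R) by (apply pow_le; lra).
  destruct (Z_le_gt_dec 0 n).
  - apply Rle_trans with (D1 * (1 / 2) ^ Z.abs_nat n)%R.
    + replace n with (Z.of_nat (Z.abs_nat n)) at 1 by lia; apply H1.
    + apply Rmult_le_compat_r; [exact Hp|apply Rmax_l].
  - apply Rle_trans with (D2 * (1 / 2) ^ Z.abs_nat n)%R.
    + rewrite theta_term_swap.
      replace (- n)%Z with (Z.of_nat (Z.abs_nat n)) by lia; apply H2.
    + apply Rmult_le_compat_r; [exact Hp|apply Rmax_r].
Qed.

(** Let M = N tend to infinity in the finite form. The products tend to [P], the series to [T] / [L]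
    by dominated convergence, and uniqueness of limits gives [T] = [L] [P]. *)
Theorem jacobi_triple_product (a b y : C) : (Cmod (a * b) < 1)%R ->
  is_ZSeries (theta_term a b y)
    (qPochs [a * b; - a * Cexp y; - b * Cexp (- y)] (a * b)).
Proof.
  intros Hq; destruct (theta_term_geom a b y Hq) as [D HD].
  assert (Eabs := ex_ZSeries_abs_geom _ (fun n => n) D HD (fun n => Nat.le_refl _)).
  assert (HT := ex_ZSeries_abs_is _ Eabs).
  set (T := ZSeries (theta_term a b y)) in HT.
  set (q := a * b) in *.
  set (L := qPoch q q).
  assert (HL : L <> 0) by now apply qPoch_self_neq_0.
  set (P := qPoch (- a * Cexp y) q * qPoch (- b * Cexp (- y)) q).
  assert (H1 : filterlim (fun N => qprod (- a * Cexp y) q N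
      * qprod (- b * Cexp (- y)) q N) eventually (locally P)).
  { apply Clim_mult; now apply qPoch_lim. }
  set (B := exp (Cmod q / (1 - Cmod q))).
  set (B' := exp (Cmod q / (1 - Cmod q) / (1 - Cmod q))).
  assert (H2 : filterlim (fun N => qprod (- a * Cexp y) q N
      * qprod (- b * Cexp (- y)) q N) eventually (locally (/ L * T))).
  { apply is_ZSeries_dominated with
      (u := fun N n => qprod q q (N + N)
        * inv_qfact q (Z.of_nat N - n) * inv_qfact q (Z.of_nat N + n)
        * theta_term a b y n)
      (v := fun n => / L * theta_term a b y n)
      (* [B] bounds |(q)_(2N)| and [B'] each reciprocal factor, uniformly in N and n. *)
      (g := fun n => (B * B' * B' * Cmod (theta_term a b y n))%R).
    - exact (ex_series_scal_l (V := R_NormedModule) _ _ (proj1 Eabs)).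
    - exact (ex_series_scal_l (V := R_NormedModule) _ _ (proj2 Eabs)).
    - intros N n; rewrite !Cmod_mult.
      apply Rmult_le_compat_r; [apply Cmod_ge_0|].
      apply Rmult_le_compat; try apply Cmod_ge_0; [| |now apply inv_qfact_le].
      + apply Rmult_le_pos; apply Cmod_ge_0.
      + apply Rmult_le_compat; try apply Cmod_ge_0;
          [now apply qprod_le|now apply inv_qfact_le].
    - intros n.
      (* The three q-factors tend to [L], 1/[L] and 1/[L]. *)
      replace (/ L * theta_term a b y n)
        with (L * / L * / L * theta_term a b y n) by (field; exact HL).
      apply Clim_mult; [|apply filterlim_const].
      apply Clim_mult; [apply Clim_mult|].
      + apply (filterlim_comp _ _ _ (fun N => (N + N)%nat) (qprod q q)
          _ eventually).
        * intros Q [K HK]; exists K; intros N HN; apply HK; lia.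
        * now apply qPoch_lim.
      + now apply (inv_qfact_lim q (- n)).
      + now apply inv_qfact_lim.
    - intros N; now apply finite_jacobi_triple.
    - now apply is_ZSeries_scal. }
  assert (E := Clim_unique _ _ _ H1 H2).
  replace (qPochs _ _) with T; [exact HT|].
  transitivity (L * P); [rewrite E; field; exact HL|].
  unfold qPochs, P, L; simpl; ring.
Qed.

(** * Cube roots of unity and the splitting of the theta series modulo 3 *)

Lemma Cexp_2PI_IZR (m : Z) : Cexp (2 * PI * Ci * IZR m) = 1.
Proof.
  assert (H1 : Cexp (2 * PI * Ci) = 1).
  { unfold Cexp; simpl.
    replace (_ * 0 - _ * 1)%R with 0%R by ring.
    replace (_ * 1 + _ * 0)%R with (2 * PI)%R by ring.
    rewrite exp_0, cos_2PI, sin_2PI; unfold RtoC; f_equal; ring. }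
  assert (HS : forall k, Cexp (2 * PI * Ci * IZR (k + 1)) = Cexp (2 * PI * Ci * IZR k)).
  { intros k; rewrite plus_IZR, RtoC_plus.
    replace (2 * PI * Ci * (IZR k + 1)) with (2 * PI * Ci * IZR k + 2 * PI * Ci)
      by ring.
    rewrite Cexp_plus, H1; ring. }
  induction m as [|k IH|k IH] using Z.peano_ind.
  - rewrite Cmult_0_r; apply Cexp_0.
  - unfold Z.succ; now rewrite HS.
  - rewrite <- HS; now replace (Z.pred k + 1)%Z with k by lia.
Qed.

Lemma Cexp_2PI_3_sum :
  Cexp (2 * PI * Ci / 3) + Cexp (- (2 * PI * Ci / 3)) = - (1).
Proof.
  replace (2 * PI * Ci / 3) with ((0, 2 * (PI / 3))%R : C).
  - unfold Cexp, Cplus, Copp, RtoC, Re, Im; simpl.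
    rewrite Ropp_0, exp_0, cos_neg, sin_neg, cos_2PI3; f_equal; field.
  - unfold Cdiv, Cinv, Cmult, Ci, RtoC; simpl; f_equal; field.
Qed.

(** The convergence clauses give the limits in the identity their meaning, since [CLim_seq] is a
    choice of limit. *)
Theorem lemma4 (a b x : C) (hab : (Cmod (a * b) < 1)%R) :
  let f0 := fun m : Z =>
    a ^ Z.to_nat (3 * m * (3 * m + 1) / 2)
    * b ^ Z.to_nat (3 * m * (3 * m - 1) / 2)
    * Cexp (2 * PI * Ci * IZR m * x) in
  let f1 := fun m : Z =>
    a ^ Z.to_nat ((3 * m + 1) * (3 * m + 2) / 2)
    * b ^ Z.to_nat (3 * m * (3 * m + 1) / 2)
    * Cexp (2 * PI * Ci * (IZR m + 1 / 3) * x) in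
  let f2 := fun m : Z =>
    a ^ Z.to_nat (3 * m * (3 * m - 1) / 2)
    * b ^ Z.to_nat ((3 * m - 1) * (3 * m - 2) / 2)
    * Cexp (2 * PI * Ci * (IZR m - 1 / 3) * x) in
  ex_ZSeries_abs f0 /\ ex_ZSeries_abs f1 /\ ex_ZSeries_abs f2
  /\ (forall alpha : C, ex_qPoch alpha (a * b))
  /\ 2 * sqrt 3 / (1 + sqrt 3) * ZSeries f0
     - sqrt 3 * (ZSeries f1 + ZSeries f2)
     = qPochs [a * b;
               - a * Cexp (2 * PI * Ci * (x + 1) / 3);
               - b * Cexp (- (2 * PI * Ci * (x + 1)) / 3)] (a * b)
       + qPochs [a * b;
                 - a * Cexp (2 * PI * Ci * (x - 1) / 3);
                 - b * Cexp (- (2 * PI * Ci * (x - 1)) / 3)] (a * b)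
       - 2 / (1 + sqrt 3)
         * qPochs [a * b;
                   - a * Cexp (2 * PI * Ci * x / 3);
                   - b * Cexp (- (2 * PI * Ci * x) / 3)] (a * b).
Proof.
  intros f0 f1 f2.
  set (y := 2 * PI * Ci * x / 3).
  set (w := 2 * PI * Ci / 3).
  assert (H3 : RtoC 3 <> 0) by (intros E; apply RtoC_inj in E; lra).
  (* The three series on the left are one theta series restricted to the residues 0, 1 and -1 modulo
     3. *)
  assert (F0 : forall m, theta_term a b y (3 * m) = f0 m).
  { intros m; unfold theta_term, f0; do 2 f_equal.
    unfold y; rewrite mult_IZR, RtoC_mult; field; exact H3. }
  assert (F1 : forall m, theta_term a b y (3 * m + 1) = f1 m).
  { intros m; unfold theta_term, f1.
    replace (3 * m + 1 + 1)%Z with (3 * m + 2)%Z by ring.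
    replace ((3 * m + 1) * (3 * m + 1 - 1))%Z with (3 * m * (3 * m + 1))%Z by ring.
    do 2 f_equal.
    unfold y; rewrite plus_IZR, mult_IZR, RtoC_plus, RtoC_mult; field; exact H3. }
  assert (F2 : forall m, theta_term a b y (3 * m - 1) = f2 m).
  { intros m; unfold theta_term, f2.
    replace ((3 * m - 1) * (3 * m - 1 + 1))%Z with (3 * m * (3 * m - 1))%Z by ring.
    replace (3 * m - 1 - 1)%Z with (3 * m - 2)%Z by ring.
    do 2 f_equal.
    unfold y; rewrite minus_IZR, mult_IZR, RtoC_minus, RtoC_mult; field; exact H3. }
  assert (A : ex_ZSeries_abs f0 /\ ex_ZSeries_abs f1 /\ ex_ZSeries_abs f2).
  { destruct (theta_term_geom a b y hab) as [D HD].
    assert (K : forall (f : Z -> C) (k : Z -> Z),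
      (forall m, (Z.abs_nat m <= Z.abs_nat (k m))%nat) ->
      (forall m, theta_term a b y (k m) = f m) -> ex_ZSeries_abs f).
    { intros f k Hk Hf.
      destruct (ex_ZSeries_abs_geom _ k D HD Hk) as [K1 K2].
      split; [apply ex_series_ext with (2 := K1)|apply ex_series_ext with (2 := K2)];
        intros n; now rewrite Hf. }
    split; [apply (K _ (fun m => 3 * m)%Z)|split;
      [apply (K _ (fun m => 3 * m + 1)%Z)|apply (K _ (fun m => 3 * m - 1)%Z)]];
      trivial; intros m; lia. }
  destruct A as (A0 & A1 & A2); do 3 (split; [assumption|]).
  split; [intros alpha; now apply ex_qPoch_lt_1|].
  set (s := RtoC (sqrt 3)).
  assert (Hs : s * s = 3).
  { unfold s; rewrite <- RtoC_mult, sqrt_sqrt by lra; reflexivity. }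
  assert (Hs1 : 1 + s <> 0).
  { unfold s; rewrite <- RtoC_plus; intros E; apply RtoC_inj in E.
    generalize (sqrt_pos 3); lra. }
  assert (Hk : 2 / (1 + s) = s - 1).
  { replace (RtoC 2) with ((s - 1) * (1 + s)); [field; exact Hs1|].
    replace ((s - 1) * (1 + s)) with (s * s - 1) by ring; rewrite Hs; ring. }
  assert (Hk0 : 2 * s / (1 + s) = 3 - s).
  { replace (2 * s / (1 + s)) with (s * (2 / (1 + s))) by (field; exact Hs1).
    rewrite Hk, <- Hs; ring. }
  rewrite Hk, Hk0.
  (* Replacing x by x + t twists the n-th term by e^(2 pi i n t/3); the values t = 1, -1, 0 give the
     three products on the right. *)
  assert (T : forall t, is_ZSeries
    (fun n => theta_term a b y n * Cexp (IZR n * (w * t)))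
    (qPochs [a * b; - a * Cexp (2 * PI * Ci * (x + t) / 3);
             - b * Cexp (- (2 * PI * Ci * (x + t)) / 3)] (a * b))).
  { intros t; replace (- (2 * PI * Ci * (x + t)) / 3)
      with (- (2 * PI * Ci * (x + t) / 3)) by (field; exact H3).
    apply is_ZSeries_ext with (2 := jacobi_triple_product a b _ hab).
    intros n; unfold theta_term.
    replace (IZR n * (2 * PI * Ci * (x + t) / 3))
      with (IZR n * y + IZR n * (w * t))
      by (unfold y, w; field; exact H3).
    rewrite Cexp_plus; ring. }
  assert (W0 : forall m r, Cexp (IZR (3 * m + r) * w) = Cexp (IZR r * w)).
  { intros m r; rewrite plus_IZR, mult_IZR, RtoC_plus, RtoC_mult.
    replace ((3 * IZR m + IZR r) * w) with (2 * PI * Ci * IZR m + IZR r * w)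
      by (unfold w; field; exact H3).
    rewrite Cexp_plus, Cexp_2PI_IZR; ring. }
  (* The combined twist for t = 1 and t = -1 is 2 cos(2 pi n/3), with values 2, -1, -1 on the
     residues 0, 1, 2. *)
  set (W := fun n => Cexp (IZR n * (w * 1)) + Cexp (IZR n * (w * - (1)))).
  assert (HW : forall m r, W (3 * m + r)%Z = Cexp (IZR r * w) + Cexp (IZR (- r) * w)).
  { intros m r; unfold W.
    rewrite Cmult_1_r, W0; f_equal.
    rewrite <- (W0 (- m)%Z (- r)%Z).
    replace (3 * - m + - r)%Z with (- (3 * m + r))%Z by ring.
    rewrite (opp_IZR (3 * m + r)), RtoC_opp; f_equal; ring. }
  assert (HW0 : forall m, W (3 * m)%Z = 2).
  { intros m; rewrite <- (Z.add_0_r (3 * m)), HW; simpl Z.opp.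
    rewrite Cmult_0_l, Cexp_0; ring. }
  assert (HW1 : forall m, W (3 * m + 1)%Z = - (1)).
  { intros m; rewrite HW, <- Cexp_2PI_3_sum; fold w.
    f_equal; f_equal; [ring|rewrite opp_IZR, RtoC_opp; ring]. }
  assert (HW2 : forall m, W (3 * m + 2)%Z = - (1)).
  { intros m; replace (3 * m + 2)%Z with (3 * (m + 1) + -1)%Z by ring.
    rewrite HW, Cplus_comm, <- Cexp_2PI_3_sum; fold w.
    f_equal; f_equal.
    - simpl Z.opp; ring.
    - change (-1)%Z with (- (1))%Z; rewrite opp_IZR, RtoC_opp; ring. }
  match goal with |- _ = ?p1 + ?p2 - _ * ?p0 =>
    set (P0 := p0); set (P1 := p1); set (P2 := p2) end.
  set (rhs := P1 + P2 - (s - 1) * P0).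
  (* The weights 2 - (s - 1) = 3 - s and -1 - (s - 1) = -s are the coefficients on the left. *)
  set (h := fun n => theta_term a b y n * (W n - (s - 1))).
  assert (HR : is_ZSeries h rhs).
  { assert (T0 := T 0); rewrite Cplus_0_r in T0.
    replace rhs with (rhs + (s - 1) * P0 + - (s - 1) * P0) by ring.
    replace (rhs + (s - 1) * P0) with (P1 + P2) by (unfold rhs; ring).
    apply is_ZSeries_ext with (2 := is_ZSeries_plus _ _ _ _
      (is_ZSeries_plus _ _ _ _ (T 1) (T (- (1))))
      (is_ZSeries_scal (- (s - 1)) _ _ T0)).
    intros n; unfold h, W.
    rewrite Cmult_0_r, Cmult_0_r, Cexp_0; ring. }
  apply is_ZSeries_group3 in HR.
  rewrite <- (is_ZSeries_unique _ _ HR); symmetry; apply is_ZSeries_unique.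
  (* The series of [f2] is shifted by one because the blocks use 3m + 2 = 3(m + 1) - 1. *)
  assert (HL := is_ZSeries_plus _ _ _ _
    (is_ZSeries_scal (3 - s) _ _ (ex_ZSeries_abs_is _ A0))
    (is_ZSeries_scal (- s) _ _ (is_ZSeries_plus _ _ _ _ (ex_ZSeries_abs_is _ A1)
      (is_ZSeries_succ _ _ (ex_ZSeries_abs_is _ A2))))).
  replace ((3 - s) * ZSeries f0 - s * (ZSeries f1 + ZSeries f2))
    with ((3 - s) * ZSeries f0 + - s * (ZSeries f1 + ZSeries f2)) by ring.
  apply is_ZSeries_ext with (2 := HL); intros m; unfold h.
  rewrite HW0, HW1, HW2, <- F0, <- F1, <- F2.
  replace (3 * (m + 1) - 1)%Z with (3 * m + 2)%Z by ring.
  ring.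
Qed.
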